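(* Let $b$ be a prime, let $\alpha,d\in\mathbb{N}$, and let $(\gamma_u)_{u}$ be nonnegative real weights indexed by the finite subsets $u\subset\mathbb{N}$. For each $m,s\in\mathbb{N}$ let $p\in\mathbb{F}_b[x]$ be irreducible with $\deg(p)=m$ and let $\boldsymbol{q}=(q_1,\ldots,q_{ds})$ be constructed by the component-by-component algorithm described in the context, using the weights $\boldsymbol{\gamma}=(\gamma_u)_{u\subseteq\{1,\ldots,s\}}$. Then, with $C_{\alpha,d,\lambda,d}$ as in the context, the following hold. 1. (General weights.) If $\lim_{s\to\infty}\sum_{\emptyset\ne u\subseteq\{1,\ldots,s\}}\gamma_u^\lambda C_{\alpha,d,\lambda,d}^{|u|}<\infty$ for some $1/(2\min(\alpha,d)+1)<\lambda\le1$, then $B_{\alpha,d,\boldsymbol{\gamma}}(\boldsymbol{q},p)$ is bounded independently of the dimension: there is a constant $K$, independent of $s$ and $m$, with $B_{\alpha,d,\boldsymbol{\gamma}}(\boldsymbol{q},p)\le K$. 2. (General weights.) If $\limsup_{s\to\infty}\left[\frac1{s^q}\sum_{\emptyset\ne u\subseteq\{1,\ldots,s\}}\gamma_u^\lambda C_{\alpha,d,\lambda,d}^{|u|}\right]<\infty$ for some $1/(2\min(\alpha,d)+1)<\lambda\le1$ and some real $q>0$, then $B_{\alpha,d,\boldsymbol{\gamma}}(\boldsymbol{q},p)$ has a bound depending polynomially on the dimension with degree $q/\lambda$: there is a constant $K$, independent of $s$ and $m$, with $B_{\alpha,d,\boldsymbol{\gamma}}(\boldsymbol{q},p)\le Ks^{q/\lambda}$.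 3. (Product weights $\gamma_u=\prod_{j\in u}\gamma_j$.) If $\sum_{j=1}^\infty\gamma_j^\lambda<\infty$ for some $1/(2\min(\alpha,d)+1)<\lambda\le1$, then $B_{\alpha,d,\boldsymbol{\gamma}}(\boldsymbol{q},p)$ is bounded independently of the dimension: there is a constant $K$, independent of $s$ and $m$, with $B_{\alpha,d,\boldsymbol{\gamma}}(\boldsymbol{q},p)\le K$. 4. (Product weights $\gamma_u=\prod_{j\in u}\gamma_j$.) If $A:=\limsup_{s\to\infty}\frac{\sum_{j=1}^s\gamma_j}{\log s}<\infty$, then for every $\eta>0$ the quantity $B_{\alpha,d,\boldsymbol{\gamma}}(\boldsymbol{q},p)$ has a bound depending polynomially on the dimension with degree $C_{\alpha,d,1,d}(A+\eta)$: there is a constant $K$ (which may depend on $\eta$), independent of $s$ and $m$, with $B_{\alpha,d,\boldsymbol{\gamma}}(\boldsymbol{q},p)\le Ks^{C_{\alpha,d,1,d}(A+\eta)}$.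
   Context: Notation. $\mathbb{F}_b$ is the field with $b$ elements, identified with $\{0,\ldots,b-1\}$. Each integer $0\le n<b^m$ with base-$b$ digits $n=\nu_0+\nu_1b+\cdots+\nu_{m-1}b^{m-1}$ is identified with the polynomial $n(x)=\nu_0+\nu_1x+\cdots+\nu_{m-1}x^{m-1}\in\mathbb{F}_b[x]$. The map $v_m:\mathbb{F}_b((x^{-1}))\to[0,1)$ is $v_m\left(\sum_{l=w}^\infty t_lx^{-l}\right)=\sum_{l=\max(1,w)}^m t_lb^{-l}$. $R_{b,m}=\{q\in\mathbb{F}_b[x]:\deg(q)<m,\ q\ne0\}$. For $1\le\tau\le ds$, $\boldsymbol{q}_\tau=(q_1,\ldots,q_\tau)$. An empty sum is $0$ and an empty product is $1$; the set $\{1,\ldots,0\}$ is empty. Constants. $D_{\alpha,d}=4^{\max(d-\alpha,0)}b^{(2d-1)\alpha}$ and, for $1/(2\min(\alpha,d)+1)<\lambda\le 1$, $$\tilde C_{\alpha,d,\lambda}=\max\left\{\left(\frac{(b-1)^2}{b^\alpha(b^{2\min(\alpha,d)}-1)}\right)^\lambda,\ \frac{(b-1)^{1+\lambda}}{b^{\lambda(\alpha-1)}(b^{(2\min(\alpha,d)+1)\lambda}-b)}\right\},$$ $$C_{\alpha,d,\lambda,a}=D_{\alpha,d}^\lambda\left(-1+(1+\tilde C_{\alpha,d,\lambda})^a\right)\quad(a\in\mathbb{N}).$$ For $q_1,\ldots,q_\tau\in\mathbb{F}_b[x]$ put $z_{n,i}=v_m\left(n(x)q_i(x)/p(x)\right)\in[0,1)$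 for $0\le n<b^m$, $1\le i\le\tau$. For $z\in[0,1)$ let $$\phi_{\alpha,d}(z)=\frac{(b-1)\left(b-1-b^{2\min(\alpha,d)\lfloor\log_bz\rfloor}(b^{2\min(\alpha,d)+1}-1)\right)}{b^\alpha(b^{2\min(\alpha,d)}-1)},$$ with the convention $b^{2\min(\alpha,d)\lfloor\log_b0\rfloor}=0$. Quality criterion. For $1\le\tau\le ds$ and $\beta=\lceil\tau/d\rceil$, $$B_{\alpha,d,\boldsymbol{\gamma}}(\boldsymbol{q}_\tau,p)=\frac1{b^m}\sum_{n=0}^{b^m-1}\sum_{\emptyset\ne v\subseteq\{1,\ldots,\beta-1\}}\gamma_vD_{\alpha,d}^{|v|}\prod_{j\in v}\Big[-1+\prod_{k=1}^d(1+\phi_{\alpha,d}(z_{n,(j-1)d+k}))\Big]$$ $$+\frac1{b^m}\sum_{n=0}^{b^m-1}\sum_{\{\beta\}\subseteq v\subseteq\{1,\ldots,\beta\}}\gamma_vD_{\alpha,d}^{|v|}\prod_{j\in v\setminus\{\beta\}}\Big[-1+\prod_{k=1}^d(1+\phi_{\alpha,d}(z_{n,(j-1)d+k}))\Big]\Big[-1+\prod_{k=1}^{\tau-(\beta-1)d}(1+\phi_{\alpha,d}(z_{n,(\beta-1)d+k}))\Big],$$ and $B_{\alpha,d,\boldsymbol{\gamma}}(\boldsymbol{q},p)$ denotes the case $\tau=ds$. Component-by-component algorithm. Given $b,s,d,m,\alpha,\boldsymbol{\gamma}$: (1) choose an irreducible $p\in\mathbb{F}_b[x]$ with $\deg(p)=m$;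 (2) set $q_1=1$; (3) for $\tau=2,\ldots,ds$, choose $q_\tau$ minimizing $B_{\alpha,d,\boldsymbol{\gamma}}((\boldsymbol{q}_{\tau-1},\tilde q_\tau),p)$ as a function of $\tilde q_\tau\in R_{b,m}$. *)

(* Defs.v *)
From HB Require Import structures.
From mathcomp Require Import all_boot all_order all_algebra finmap.
From mathcomp Require Import zify.
From mathcomp Require Import all_classical all_reals all_analysis.

Set Implicit Arguments.
Unset Strict Implicit.
Unset Printing Implicit Defensive.

Import Order.TTheory GRing.Theory Num.Theory.
Import numFieldNormedType.Exports.

Local Open Scope ring_scope.

(* A formal Laurent series in x^{-1}: [lcoef t l] is the coefficient of x^{-l}. *)
Record laurent (F : fieldType) := Laurent {
  lcoef :> int -> F;
  lcoef_bounded : exists w : int, forall l : int, l < w -> lcoef l = 0 }.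

Definition lpoly_coef (F : fieldType) (f : {poly F}) (l : int) : F :=
  match l with
  | Posz 0 => f`_0
  | Posz _.+1 => 0
  | Negz n => f`_n.+1
  end.

Definition lpmul_coef (F : fieldType) (p : {poly F}) (t : int -> F) (l : int)
    : F :=
  \sum_(i < size p) p`_i * t (l + i%:Z).

(* The coefficient of x^{-l} in f / p, for l >= 0, is the constant term of the
   polynomial part of x^l f / p; [ldivP] below characterizes the quotient. *)
Definition ldiv_coef (F : fieldType) (f p : {poly F}) (l : int) : F :=
  match l with
  | Posz n => ((f * 'X^n) %/ p)`_0
  | Negz n => (f %/ p)`_n.+1
  end.

Lemma ldiv_bounded (F : fieldType) (f p : {poly F}) :
  exists w : int, forall l : int, l < w -> ldiv_coef f p l = 0.
Proof.
exists (- (size f)%:Z) => -[n|n] /=.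
  move=> h; have := lt_le_trans h (_ : - (size f)%:Z <= 0).
  by rewrite oppr_le0 => /(_ isT).
rewrite NegzE ltrN2 ltz_nat => sfn; apply: nth_default.
by apply: leq_trans (ltnW sfn); apply: leq_divp.
Qed.

Definition ldiv (F : fieldType) (f p : {poly F}) : laurent F :=
  Laurent (ldiv_bounded f p).

Lemma ldiv_shift (F : fieldType) (p g : {poly F}) (N j : nat) : p != 0 ->
  ((g * 'X^N) %/ p)`_(j + N) = (g %/ p)`_j.
Proof.
move=> p0; rewrite {1}(divp_eq g p) mulrDl mulrAC divp_addl_mul //.
rewrite coefD coefMXn ltnNge leq_addl /= addnK [X in _ + X]nth_default ?addr0 //.
rewrite size_divp //; have rp : (size (g %% p)%R < size p)%N by rewrite ltn_modp.
apply: leq_trans (leq_addl j N); rewrite leq_subLR.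
apply: (leq_trans (size_polyMleq _ _)); rewrite size_polyXn addnS /=.
by rewrite leq_add2r -ltnS prednK // (leq_ltn_trans _ rp).
Qed.

Lemma ldiv_coefE (F : fieldType) (p f : {poly F}) (N j : nat) : p != 0 ->
  ldiv_coef f p (N%:Z - j%:Z) = ((f * 'X^N) %/ p)`_j.
Proof.
move=> p0; case: (leqP j N) => [jN|Nj].
  rewrite subzn //=; have := ldiv_shift (f * 'X^(N - j)) j 0 p0.
  by rewrite -mulrA -exprD subnK.
have -> : N%:Z - j%:Z = Negz (j - N).-1.
  by rewrite NegzE prednK ?subn_gt0 // -subzn ?opprB // ltnW.
by rewrite /= prednK ?subn_gt0 // -{2}(subnK (ltnW Nj)) ldiv_shift.
Qed.

Lemma ldiv_mul (F : fieldType) (f p : {poly F}) (k : int) : p != 0 ->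
  lpmul_coef p (ldiv f p) k = lpoly_coef f k.
Proof.
move=> p0; pose M := (size p + absz k)%N; pose N := absz (k + M%:Z).
have NE : k + M%:Z = N%:Z.
  by rewrite /N /M; lia.
have kE (i : nat) : (i < size p)%N -> k + i%:Z = N%:Z - (M - i)%N%:Z.
  move=> ip; rewrite -NE -subzn; last by rewrite (leq_trans (ltnW ip)) ?leq_addr.
  by rewrite opprB addrA addrAC addrK.
have MX : (p * ((f * 'X^N) %/ p))`_M = lpmul_coef p (ldiv f p) k.
  rewrite coefM /lpmul_coef.
  rewrite (big_ord_widen_cond M.+1 xpredT
      (fun i => p`_i * ldiv f p (k + i%:Z))); last first.
    by rewrite /M; lia.
  rewrite [RHS]big_mkcond /=; apply: eq_bigr => i _.
  case: ltnP => ip; last by rewrite nth_default ?mul0r.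
  by congr (_ * _); rewrite kE // ldiv_coefE.
rewrite -MX mulrC.
have -> : (f * 'X^N) %/ p * p = f * 'X^N - (f * 'X^N) %% p.
  by rewrite {2}(divp_eq (f * 'X^N) p) addrK.
rewrite coefB [X in _ - X]nth_default ?subr0; last first.
  by rewrite (leq_trans (ltnW (_ : _ < size p)%N)) ?ltn_modp // leq_addr.
rewrite coefMXn.
have kMN : k = N%:Z - M%:Z by rewrite -NE addrK.
rewrite [in RHS]kMN; case: ltnP => [MN|NM].
  by rewrite subzn 1?ltnW //; case: (N - M)%N (subn_gt0 M N) => [|n]; rewrite ?MN.
case: (ltngtP N M) NM => // [NM|->] _; last by rewrite subnn subrr.
have -> : N%:Z - M%:Z = Negz (M - N).-1.
  by rewrite NegzE prednK ?subn_gt0 // -subzn ?opprB // ltnW.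
by rewrite /= prednK ?subn_gt0.
Qed.

Lemma lpmul_inj (F : fieldType) (p : {poly F}) (t : laurent F) : p != 0 ->
  (forall k : int, lpmul_coef p t k = 0) -> forall l : int, t l = 0.
Proof.
move=> p0 pt0; have [w tw] := lcoef_bounded t.
have H (n : nat) (l : int) : l < w + n%:Z -> t l = 0.
  elim: n l => [|n IH] l; first by rewrite addr0; exact: tw.
  move=> ln; have := pt0 (l - (size p).-1%:Z); rewrite /lpmul_coef.
  have sp : (0 < size p)%N by rewrite size_poly_gt0.
  rewrite -(prednK sp) big_ord_recr /= big1 ?add0r; last first.
    move=> i _; rewrite IH ?mulr0 //.
    case: i => j /=; move: (size p).-1 ln => e ln je.
    by clear -ln je; lia.
  rewrite subrK => /eqP; rewrite mulf_eq0 -lead_coefE lead_coef_eq0.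
  by rewrite (negPf p0) => /eqP.
move=> l; apply: (H (absz (l - w + 1)) l); lia.
Qed.

(* [ldiv f p] is the quotient f / p in F((x^{-1})): the only Laurent series t
   with p t = f. *)
Lemma ldivP (F : fieldType) (f p : {poly F}) (t : laurent F) : p != 0 ->
  (forall k, lpmul_coef p t k = lpoly_coef f k) <->
  (forall l, t l = ldiv f p l).
Proof.
move=> p0; split=> [pt l|tE k]; last first.
  by rewrite -(ldiv_mul f k p0); apply: eq_bigr => i _; rewrite tE.
have dB : exists w : int, forall l : int, l < w -> t l - ldiv f p l = 0.
  have [w1 h1] := lcoef_bounded t; have [w2 h2] := lcoef_bounded (ldiv f p).
  exists (Order.min w1 w2) => l'; rewrite lt_min => /andP[/h1-> /h2->].
  by rewrite subrr.
apply/eqP; rewrite -subr_eq0; apply/eqP.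
apply: (@lpmul_inj _ p (Laurent dB)) => // k.
rewrite /lpmul_coef /=; under eq_bigr do rewrite mulrBr.
rewrite sumrB; have := pt k; have := ldiv_mul f k p0.
by rewrite /lpmul_coef /= => -> ->; rewrite subrr.
Qed.

(* The coefficients t_l, elements of 'F_b, are read as integers 0, ..., b - 1. *)
Definition vmap (R : realType) (b m : nat) (t : laurent 'F_b) : R :=
  \sum_(1 <= l < m.+1) (t l%:Z : nat)%:R / b%:R ^+ l.

Definition digit_poly (b m n : nat) : {poly 'F_b} :=
  \poly_(i < m) ((n %/ b ^ i) %% b)%N%:R.

Definition inR (b m : nat) (q : {poly 'F_b}) : bool :=
  (q != 0) && (size q <= m)%N.

(* Vectors (q_1, ..., q_tau) are sequences, so q_i is entry i - 1. *)
Definition zpt (R : realType) (b m : nat) (p : {poly 'F_b})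
    (q : seq {poly 'F_b}) (n i : nat) : R :=
  vmap R m (ldiv (digit_poly b m n * nth 0 q i.-1) p).

Definition phi (R : realType) (b alpha d : nat) (z : R) : R :=
  let mu := minn alpha d in
  let w := if z == 0 then 0
           else b%:R ^ ((2 * mu)%:Z * Num.floor (ln z / ln b%:R)) in
  (b%:R - 1) * (b%:R - 1 - w * (b%:R ^+ (2 * mu + 1) - 1))
  / (b%:R ^+ alpha * (b%:R ^+ (2 * mu) - 1)).

Definition Dcst (R : realType) (b alpha d : nat) : R :=
  4%:R ^+ (d - alpha) * b%:R ^+ ((2 * d - 1) * alpha).

Definition Ctilde (R : realType) (b alpha d : nat) (lambda : R) : R :=
  let mu := minn alpha d in
  Num.max
    (((b%:R - 1) ^+ 2 / (b%:R ^+ alpha * (b%:R ^+ (2 * mu) - 1))) `^ lambda)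
    ((b%:R - 1) `^ (1 + lambda)
     / (b%:R `^ (lambda * (alpha%:R - 1))
        * (b%:R `^ ((2 * mu + 1)%N%:R * lambda) - b%:R))).

Definition Ccst (R : realType) (b alpha d : nat) (lambda : R) (a : nat) : R :=
  Dcst R b alpha d `^ lambda * (-1 + (1 + Ctilde b alpha d lambda) ^+ a).

(* The set {1, ..., n}.  Weights gamma_u are indexed by the finite sets u of
   positive integers; the values of gamma on sets containing 0 are never used. *)
Definition upto (n : nat) : {fset nat} := [fset j in iota 1 n]%fset.

Definition blockprod (R : realType) (b m alpha d : nat) (p : {poly 'F_b})
    (q : seq {poly 'F_b}) (n j r : nat) : R :=
  -1 + \prod_(1 <= k < r.+1)
         (1 + phi b alpha d (zpt R m p q n ((j - 1) * d + k))).

Definition Bcrit (R : realType) (b m alpha d : nat) (gamma : {fset nat} -> R)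
    (p : {poly 'F_b}) (q : seq {poly 'F_b}) : R :=
  let tau := size q in
  let beta := ((tau + d - 1) %/ d)%N in (* the ceiling of tau / d *)
  let D := Dcst R b alpha d in
  (b ^ m)%:R^-1 *
    (\sum_(0 <= n < b ^ m)
      \sum_(v <- fpowerset (upto (beta - 1)) | v != fset0)
        gamma v * D ^+ #|` v| *
        \prod_(j <- v) blockprod R m alpha d p q n j d)
  + (b ^ m)%:R^-1 *
    (\sum_(0 <= n < b ^ m)
      \sum_(v <- fpowerset (upto beta) | beta \in v)
        gamma v * D ^+ #|` v| *
        (\prod_(j <- (v `\ beta)%fset) blockprod R m alpha d p q n j d) *
        blockprod R m alpha d p q n beta (tau - (beta - 1) * d)).

(* (p, q) is a possible outcome of the component-by-component algorithm: no
   assumption is made on how ties are broken in the minimizations. *)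
Definition cbc (R : realType) (b s d m alpha : nat) (gamma : {fset nat} -> R)
    (p : {poly 'F_b}) (q : (d * s).-tuple {poly 'F_b}) : Prop :=
  [/\ irreducible_poly p, size p = m.+1, nth 0 q 0 = 1
    & forall tau : nat, (2 <= tau <= d * s)%N ->
        inR m (nth 0 q tau.-1) /\
        forall q' : {poly 'F_b}, inR m q' ->
          Bcrit m alpha d gamma p (rcons (take tau.-1 q) (nth 0 q tau.-1)) <=
          Bcrit m alpha d gamma p (rcons (take tau.-1 q) q')].

Definition wsum (R : realType) (b alpha d : nat) (gamma : {fset nat} -> R)
    (lambda : R) (s : nat) : R :=
  \sum_(u <- fpowerset (upto s) | u != fset0)
    gamma u `^ lambda * Ccst b alpha d lambda d ^+ #|` u|.

(* Main.v *)
(* Since phi is largest in absolute value at 0, each block factor is at most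
   (1 + phi(0))^d - 1, and averaging over n bounds B by a weighted sum over the
   nonempty u of gamma_u E^|u| with E = D ((1 + phi(0))^d - 1).  Subadditivity
   of x |-> x^lambda (Jensen) then gives B^lambda <= wsum, because
   phi(0)^lambda is one of the two terms of the maximum defining Ctilde.  For
   product weights wsum = prod_j (1 + C gamma_j^lambda) - 1, which is at most
   exp (C sum_j gamma_j^lambda). *)
Require Import Defs.
From HB Require Import structures.
From mathcomp Require Import all_boot all_order all_algebra finmap.
From mathcomp Require Import all_classical all_reals all_analysis.
From mathcomp Require Import ring lra.

Set Implicit Arguments.
Unset Strict Implicit.

Import Order.TTheory GRing.Theory Num.Theory.
Import numFieldNormedType.Exports.

Local Open Scope ring_scope.

(** * Inequalities for real powers with exponent in (0, 1] *)

Lemma powRD_le (R : realType) (x y l : R) : 0 <= x -> 0 <= y -> 0 < l <= 1 ->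
  (x + y) `^ l <= x `^ l + y `^ l.
Proof.
move=> x0 y0 /andP[l0 l1].
have := addr_ge0 x0 y0; rewrite le_eqVlt => /predU1P[<-|s0].
  by rewrite powR0 ?gt_eqF// addr_ge0 ?powR_ge0.
(* With t = z / (x + y) in [0, 1], the bound t <= t^l is multiplied by (x + y)^l. The fractions of x
   and y add up to 1, so summing the two instances gives the claim. *)
have scaled (z : R) : 0 <= z -> z <= x + y ->
    z / (x + y) * (x + y) `^ l <= z `^ l.
  rewrite le_eqVlt => /predU1P[<-|z0] zs; first by rewrite !mul0r powR_ge0.
  rewrite -[in leRHS](divfK (lt0r_neq0 s0) z) powRM; last 2 first.
  - by rewrite divr_ge0 // ltW.
  - exact: ltW.
  rewrite ler_wpM2r ?powR_ge0// ger1_powR//.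
  by rewrite divr_gt0//= ler_pdivrMr// mul1r.
apply: le_trans (lerD (scaled _ x0 _) (scaled _ y0 _)); rewrite ?lerDl ?lerDr//.
by rewrite -!mulrDl divff ?mul1r// gt_eqF.
Qed.

Lemma powR_sum_le (R : realType) (I : Type) (r : seq I) (P : pred I)
    (F : I -> R) (l : R) : 0 < l <= 1 -> (forall i, P i -> 0 <= F i) ->
  (\sum_(i <- r | P i) F i) `^ l <= \sum_(i <- r | P i) F i `^ l.
Proof.
move=> l01 F0; elim: r => [|i r IH].
  by rewrite !big_nil powR0 // gt_eqF //; case/andP: l01.
rewrite !big_cons; case: ifP => // Pi.
apply: le_trans (powRD_le (F0 _ Pi) _ l01) _; first exact: sumr_ge0.
by rewrite lerD2l.
Qed.

Lemma powR_prod (R : realType) (I : eqType) (r : seq I) (F : I -> R) (l : R) :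
  (forall i, i \in r -> 0 <= F i) ->
  (\prod_(i <- r) F i) `^ l = \prod_(i <- r) F i `^ l.
Proof.
elim: r => [|i r IH] F0; first by rewrite !big_nil powR1.
have F0r j : j \in r -> 0 <= F j by move=> jr; apply: F0; rewrite in_cons jr orbT.
rewrite !big_cons powRM ?IH ?F0 ?mem_head//.
by rewrite big_seq prodr_ge0.
Qed.

(** The deviation e = P - 1 of the product evolves by e' = e (1 + x) + x, and the bound obeys the
    same recursion with c for x, so the triangle inequality carries the induction. *)
Lemma normr_prod_subr1_le (R : realDomainType) (x : nat -> R) (c : R) (r : nat) :
  0 <= c -> (forall k, `|x k| <= c) ->
  `|-1 + \prod_(1 <= k < r.+1) (1 + x k)| <= (1 + c) ^+ r - 1.
Proof.
move=> c0 xc; elim: r => [|r IH]; first by rewrite big_nil expr0 addNr subrr normr0.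
rewrite big_nat_recr//= exprSr.
set P := \prod_(1 <= k < r.+1) _ in IH *.
have -> : -1 + P * (1 + x r.+1) = (-1 + P) * (1 + x r.+1) + x r.+1 by ring.
have -> : (1 + c) ^+ r * (1 + c) - 1 = ((1 + c) ^+ r - 1) * (1 + c) + c by ring.
apply: le_trans (ler_normD _ _) _; rewrite lerD// normrM ler_pM//.
by apply: le_trans (ler_normD _ _) _; rewrite normr1 lerD2l.
Qed.

(** Each step of the same recursion is a sum of three nonnegative terms. Two uses of subadditivity
    distribute the power over them, which turns c into c^l. *)
Lemma powR_expD1_subr1_le (R : realType) (c l : R) (r : nat) :
  0 <= c -> 0 < l <= 1 ->
  ((1 + c) ^+ r - 1) `^ l <= (1 + c `^ l) ^+ r - 1.
Proof.
move=> c0 l01; have [l0 _] := andP l01.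
elim: r => [|r IH]; first by rewrite !expr0 !subrr powR0 ?gt_eqF.
rewrite !exprSr.
have -> : (1 + c) ^+ r * (1 + c) - 1
    = ((1 + c) ^+ r - 1) + (((1 + c) ^+ r - 1) * c + c) by ring.
have -> : (1 + c `^ l) ^+ r * (1 + c `^ l) - 1 = ((1 + c `^ l) ^+ r - 1)
    + (((1 + c `^ l) ^+ r - 1) * (c `^ l) + c `^ l) by ring.
have X0 : 0 <= (1 + c) ^+ r - 1 by rewrite subr_ge0 exprn_ege1// lerDl.
have Xc0 : 0 <= ((1 + c) ^+ r - 1) * c by exact: mulr_ge0.
apply: le_trans (powRD_le X0 _ l01) _; first exact: addr_ge0.
rewrite lerD//; apply: le_trans (powRD_le Xc0 c0 l01) _.
by rewrite lerD2r powRM// ler_wpM2r// powR_ge0.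
Qed.

(** * The points lie in [0, 1), and [phi] is dominated there by its value at 0 *)

Lemma vmap_ge0 (R : realType) (b m : nat) (t : laurent 'F_b) : 0 <= vmap R m t.
Proof. by apply: sumr_ge0 => i _; rewrite divr_ge0// ?exprn_ge0. Qed.

Lemma vmap_lt1 (R : realType) (b m : nat) (t : laurent 'F_b) :
  prime b -> vmap R m t < 1.
Proof.
move=> bp; have b0 : (0 : R) < b%:R by rewrite ltr0n prime_gt0.
(* The sharper bound makes the induction on m close: it is the value when all digits equal b - 1. *)
suff : vmap R m t <= 1 - b%:R ^- m.
  by move/le_lt_trans; apply; rewrite ltrBlDr ltrDl invr_gt0 exprn_gt0.
rewrite /vmap; elim: m => [|m IH]; first by rewrite big_nil expr0 invr1 subrr.
rewrite big_nat_recr//=.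
have digit_le : (t m.+1%:Z : nat)%:R <= b%:R - 1 :> R.
  rewrite lerBrDr natr1 ler_nat.
  by rewrite -[X in (_ < X)%N](Fp_cast bp); exact: ltn_ord.
apply: le_trans (lerD IH (ler_wpM2r _ digit_le)) _.
  by rewrite invr_ge0 exprn_ge0 // ltW.
rewrite le_eqVlt; apply/orP; left; apply/eqP.
rewrite exprS; field; rewrite ?expf_neq0 ?gt_eqF//.
Qed.

(** [phi] is a decreasing affine function of [w], with [w = 0] at z = 0, which gives the upper
    bound. For the lower one, z < 1 forces w <= b^(-2 mu), so the subtracted term is at most b, and
    b <= 2 (b - 1). *)
Lemma phi_norm_le (R : realType) (b alpha d : nat) (z : R) :
  (1 < b)%N -> (0 < alpha)%N -> (0 < d)%N -> 0 <= z < 1 ->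
  `|phi b alpha d z| <= phi b alpha d (0 : R).
Proof.
move=> b1 a0 d0 /andP[z0 z1]; rewrite /phi eqxx.
set mu := minn alpha d; set w := if z == 0 then _ else _.
have mu0 : (0 < mu)%N by rewrite leq_min a0.
have B1 : (1 : R) < b%:R by rewrite ltr1n.
have B0 : (0 : R) < b%:R by apply: lt_trans B1.
have E1 : (1 : R) < b%:R ^+ (2 * mu) by rewrite exprn_egt1// -lt0n muln_gt0.
have w0 : 0 <= w by rewrite /w; case: ifP => // _; rewrite exprz_ge0// ltW.
have wE : w * b%:R ^+ (2 * mu) <= 1.
  rewrite /w; case: eqP => [|/eqP zn0]; first by rewrite mul0r.
  have zgt0 : 0 < z by rewrite lt_def zn0.
  (* Since z < 1, log_b z is negative and its floor is at most -1. *)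
  have fl : Num.floor (ln z / ln b%:R) <= -1 :> int.
    rewrite -ltzD1 addNr floor_lt0 pmulr_llt0 ?invr_gt0 ?ln_gt0// ln_lt0//.
    by rewrite zgt0.
  have /(ler_weXz2l (ltW B1)) :
      (2 * mu)%:Z * Num.floor (ln z / ln b%:R) <= - (2 * mu)%:Z.
    by rewrite -mulrN1 ler_wpM2l.
  rewrite -(ler_pM2r (exprn_gt0 (2 * mu) B0)) => /le_trans; apply.
  by rewrite -exprnN mulVf// expf_neq0// gt_eqF.
have den0 : 0 < b%:R ^+ alpha * (b%:R ^+ (2 * mu) - 1) :> R.
  by rewrite mulr_gt0 ?exprn_gt0// subr_gt0.
rewrite mul0r subr0 ler_norml -mulNr !ler_pM2r ?invr_gt0// -mulrN.
rewrite !ler_pM2l ?subr_gt0// addn1 exprS.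
have B2 : (2 : R) <= b%:R by rewrite ler_nat.
move: (b%:R : R) (b%:R ^+ _) w0 wE B0 B1 B2 E1 => B E w0 wE B0 B1 B2 E1.
have BwE : B * (w * E) <= B by rewrite ler_piMr// ltW.
have wBE : 0 <= w * (B * E - 1) by rewrite mulr_ge0// subr_ge0 mulr_ege1// ltW.
have -> : w * (B * E - 1) = B * (w * E) - w by ring.
have {wBE}: 0 <= B * (w * E) - w by rewrite (_ : _ - _ = w * (B * E - 1))//; ring.
by move=> wBE; apply/andP; split; lra.
Qed.

(** * Sums over the subsets of {1, ..., n}, and averages *)

Lemma mem_upto (n j : nat) : (j \in upto n) = (0 < j <= n)%N.
Proof. by rewrite /upto !inE /= mem_iota add1n ltnS. Qed.

Lemma uptoS (n : nat) : upto n.+1 = (n.+1 |` upto n)%fset.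
Proof.
apply/fsetP => j; rewrite in_fset1U !mem_upto (leq_eqVlt j n.+1) ltnS.
by case: eqP => [->|].
Qed.

Lemma zero_notin_upto (n : nat) (v : {fset nat}) : (v `<=` upto n)%fset ->
  0%N \notin v.
Proof. by move=> vn; apply/negP => /(fsubsetP vn); rewrite mem_upto. Qed.

Lemma big_fpowerset_notin (V : nmodType) (K : choiceType) (x : K)
    (A : {fset K}) (P : pred {fset K}) (F : {fset K} -> V) : x \notin A ->
  \sum_(v <- fpowerset (x |` A)%fset | P v && (x \notin v)) F v
  = \sum_(v <- fpowerset A | P v) F v.
Proof.
move=> xA; rewrite -big_filter -[RHS]big_filter; apply: perm_big.
apply: uniq_perm; rewrite ?filter_uniq ?fset_uniq// => v.
rewrite !mem_filter !fpowersetE -andbA; congr (_ && _).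
apply/andP/idP => [[xv /fsubsetP vA]|vA].
  apply/fsubsetP => y yv; have := vA _ yv; rewrite in_fset1U => /orP[/eqP yx|//].
  by rewrite -yx yv in xv.
split; first by apply: contra xA; apply: (fsubsetP vA).
exact: fsubset_trans vA (fsubsetUr _ _).
Qed.

(** Adding x is a bijection from the subsets of [A] onto the subsets of the larger set that contain
    x; its inverse removes x. *)
Lemma big_fpowerset_in (V : nmodType) (K : choiceType) (x : K)
    (A : {fset K}) (F : {fset K} -> V) : x \notin A ->
  \sum_(v <- fpowerset (x |` A)%fset | x \in v) F v
  = \sum_(v <- fpowerset A) F (x |` v)%fset.
Proof.
move=> xA; rewrite -big_filter -(big_map (fun v => (x |` v)%fset) xpredT F).
have subA v : v \in enum_fset (fpowerset A) -> x \notin v.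
  by rewrite fpowersetE => vA; apply: contra xA; apply: (fsubsetP vA).
apply: perm_big; apply: uniq_perm.
- by rewrite filter_uniq ?fset_uniq.
- rewrite map_inj_in_uniq ?fset_uniq// => u v /subA xu /subA xv uv.
  by rewrite -(fsetU1K xu) uv fsetU1K.
move=> v; rewrite mem_filter fpowersetE; apply/andP/mapP => [[xv vA]|[u uA ->]].
  exists (v `\ x)%fset; last by rewrite fsetD1K.
  by rewrite fpowersetE fsubDset.
by rewrite fset1U1 fsetUS // -fpowersetE.
Qed.

Lemma prod_fset_const (R : pzSemiRingType) (K : choiceType) (v : {fset K})
    (c : R) : \prod_(j <- v) c = c ^+ #|` v|.
Proof. by rewrite big_const_seq count_predT -Monoid.iteropE. Qed.

Lemma mean_le (R : realFieldType) (N : nat) (F : nat -> R) (M : R) :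
  (0 < N)%N -> (forall n, F n <= M) ->
  N%:R^-1 * (\sum_(0 <= n < N) F n) <= M.
Proof.
move=> N0 FM; rewrite ler_pdivrMl ?ltr0n//.
apply: le_trans (ler_sum _ (fun n _ => FM n)) _.
by rewrite sumr_const_nat subn0 mulr_natl.
Qed.

(** * From the criterion to the weighted sum [wsum] *)

Section Criterion.
Variables (R : realType) (b alpha d : nat) (gamma : {fset nat} -> R).
Hypotheses (b_prime : prime b) (alpha_gt0 : (0 < alpha)%N) (d_gt0 : (0 < d)%N).
Hypothesis gamma_ge0 : forall u : {fset nat}, 0%N \notin u -> 0 <= gamma u.

Let phi0 : R := phi b alpha d (0 : R).
Let E : R := Dcst R b alpha d * ((1 + phi0) ^+ d - 1).

Lemma phi0_ge0 : 0 <= phi0.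
Proof.
apply: le_trans (normr_ge0 (phi b alpha d (0 : R))) _.
by rewrite phi_norm_le ?prime_gt1// lexx ltr01.
Qed.

Lemma blockprod_norm_le (m : nat) (p : {poly 'F_b}) (q : seq {poly 'F_b})
    (n j r : nat) :
  `|blockprod R m alpha d p q n j r| <= (1 + phi0) ^+ r - 1.
Proof.
apply: normr_prod_subr1_le phi0_ge0 _ => k.
by rewrite phi_norm_le ?prime_gt1// vmap_ge0 vmap_lt1.
Qed.

Lemma Dcst_ge0 : 0 <= Dcst R b alpha d.
Proof. by rewrite mulr_ge0 ?exprn_ge0. Qed.

Lemma block_ge0 : 0 <= (1 + phi0) ^+ d - 1.
Proof. by rewrite subr_ge0 exprn_ege1// lerDl phi0_ge0. Qed.

Lemma criterion_term_le (m s : nat) (p : {poly 'F_b}) (q : seq {poly 'F_b})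
    (n : nat) (v : {fset nat}) : (v `<=` upto s)%fset ->
  gamma v * Dcst R b alpha d ^+ #|` v| *
    \prod_(j <- v) blockprod R m alpha d p q n j d <= gamma v * E ^+ #|` v|.
Proof.
move=> vs; rewrite [E ^+ _]exprMn mulrA ler_wpM2l//.
  by rewrite mulr_ge0 ?exprn_ge0 ?Dcst_ge0// gamma_ge0// (zero_notin_upto vs).
(* Block factors may be negative, so the product is estimated through absolute values. *)
apply: le_trans (ler_norm _) _; rewrite normr_prod -prod_fset_const.
by apply: ler_prod => j _; rewrite normr_ge0 blockprod_norm_le.
Qed.

(** A full vector has ceiling [s] and a last block of full length [d]. The two sums of the criterion
    then run over the nonempty [v] without [s] and the [v] with [s], which together are all nonempty
    subsets. *)
Lemma Bcrit_le (m s : nat) (p : {poly 'F_b}) (q : (d * s).-tuple {poly 'F_b}) :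
  (0 < s)%N ->
  Bcrit m alpha d gamma p q
  <= \sum_(v <- fpowerset (upto s) | v != fset0) gamma v * E ^+ #|` v|.
Proof.
case: s q => // s q _; have bm0 : (0 < b ^ m)%N by rewrite expn_gt0 prime_gt0.
rewrite /Bcrit size_tuple.
have -> : ((d * s.+1 + d - 1) %/ d = s.+1)%N.
  by rewrite mulnC -addnBA// divnMDl// divn_small ?addn0// subn1 prednK.
have -> : (d * s.+1 - (s.+1 - 1) * d = d)%N by rewrite subn1 mulnC mulSn addnK.
have sNs : s.+1 \notin upto s by rewrite mem_upto ltnn andbF.
rewrite [leRHS](bigID (fun v : {fset nat} => s.+1 \in v))/= [leRHS]addrC.
rewrite [X in _ <= X + _](_ : _ = \sum_(v <- fpowerset (upto s) | v != fset0)
    gamma v * E ^+ #|` v|); last by rewrite uptoS big_fpowerset_notin.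
rewrite lerD//; apply: mean_le => // n; rewrite big_seq_cond [leRHS]big_seq_cond.
- rewrite subn1; apply: ler_sum => v; rewrite fpowersetE => /andP[vs _].
  exact: criterion_term_le vs.
(* Nonemptiness is implied by membership of the largest index, so that condition is dropped. *)
- under [leRHS]eq_bigl => v.
    rewrite (_ : _ && (_ && _) = (v \in fpowerset (upto s.+1)) && (s.+1 \in v)).
      over.
    by congr (_ && _); case: eqP => // ->; rewrite in_fset0.
  apply: ler_sum => v; rewrite fpowersetE => /andP[vs sv].
  rewrite -mulrA [X in _ * X]mulrC.
  by have := criterion_term_le m p q n vs; rewrite (big_fsetD1 _ sv).
Qed.

(** After the power is moved inside the block bound, what remains is that phi(0)^l is the first
    entry of the maximum [Ctilde]. *)
Lemma E_powR_le (l : R) : 0 < l <= 1 -> E `^ l <= Ccst b alpha d l d.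
Proof.
move=> l01; rewrite powRM ?Dcst_ge0 ?block_ge0// ler_wpM2l ?powR_ge0//.
apply: le_trans (powR_expD1_subr1_le _ phi0_ge0 l01) _.
rewrite [leRHS]addrC lerB// lerXn2r ?nnegrE ?addr_ge0 ?powR_ge0//.
  by rewrite le_max powR_ge0.
rewrite lerD2l le_max; apply/orP; left.
by rewrite /phi0 /phi eqxx mul0r subr0 expr2.
Qed.

Lemma Ccst_ge0 (l : R) : 0 < l <= 1 -> 0 <= Ccst b alpha d l d.
Proof. by move/E_powR_le; apply: le_trans; apply: powR_ge0. Qed.

Lemma Bcrit_le_wsum (m s : nat) (p : {poly 'F_b})
    (q : (d * s).-tuple {poly 'F_b}) (l : R) : (0 < s)%N -> 0 < l <= 1 ->
  Bcrit m alpha d gamma p q <= wsum b alpha d gamma l s `^ l^-1.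
Proof.
move=> s0 l01; have [l0 _] := andP l01.
apply: le_trans (Bcrit_le _ _ _ s0) _.
have E0 : 0 <= E by rewrite mulr_ge0 ?Dcst_ge0 ?block_ge0.
rewrite big_seq_cond.
have term_ge0 v : (v \in fpowerset (upto s)) && (v != fset0) ->
    0 <= gamma v * E ^+ #|` v|.
  case/andP; rewrite fpowersetE => /zero_notin_upto v0 _.
  by rewrite mulr_ge0 ?gamma_ge0 ?exprn_ge0.
set S := \sum_(_ <- _ | _) _.
have S0 : 0 <= S by exact: sumr_ge0.
(* Writing S as (S^l)^(1/l) reduces the claim to S^l <= [wsum], by monotonicity of the root. *)
rewrite -[leLHS]powRr1// -[X in _ `^ X](divff (lt0r_neq0 l0)) powRrM.
rewrite ge0_ler_powR ?invr_ge0 ?nnegrE ?powR_ge0 ?(ltW l0)//.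
  apply: sumr_ge0 => v _.
  by rewrite mulr_ge0 ?powR_ge0 ?exprn_ge0 ?Ccst_ge0.
apply: le_trans (powR_sum_le _ l01 term_ge0) _.
rewrite /wsum [leRHS]big_seq_cond; apply: ler_sum => v /andP[].
rewrite fpowersetE => /zero_notin_upto v0 _.
rewrite powRM ?gamma_ge0 ?exprn_ge0// ler_wpM2l ?powR_ge0//.
(* The exponents are exchanged, (E^k)^l = (E^l)^k, so that [E_powR_le] applies to the base. *)
rewrite -powR_mulrn// -powRrM mulrC powRrM powR_mulrn ?powR_ge0//.
by rewrite lerXn2r ?nnegrE ?powR_ge0 ?Ccst_ge0 ?E_powR_le.
Qed.

Lemma wsum_term_ge0 (l : R) (u : {fset nat}) : 0 < l <= 1 ->
  0 <= gamma u `^ l * Ccst b alpha d l d ^+ #|` u|.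
Proof. by move=> l01; rewrite mulr_ge0 ?powR_ge0 ?exprn_ge0 ?Ccst_ge0. Qed.

Lemma wsum_ge0 (l : R) (s : nat) : 0 < l <= 1 -> 0 <= wsum b alpha d gamma l s.
Proof. by move=> l01; apply: sumr_ge0 => u _; apply: wsum_term_ge0. Qed.

(** Passing from s to s + 1 only adds the nonnegative terms of the sets containing s + 1.
    Monotonicity identifies the limit of [wsum] with its supremum. *)
Lemma wsum_nondecreasing (l : R) : 0 < l <= 1 ->
  {homo wsum b alpha d gamma l : s t / (s <= t)%N >-> s <= t}.
Proof.
move=> l01; apply: homo_leq => [//|? ? ?|s]; first exact: le_trans.
rewrite /wsum -(@big_fpowerset_notin _ _ s.+1); last first.
  by rewrite mem_upto ltnn andbF.
rewrite -uptoS [leRHS](bigID (fun v : {fset nat} => s.+1 \in v))/= lerDr.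
by apply: sumr_ge0 => u _; apply: wsum_term_ge0.
Qed.

End Criterion.

(** * Tools for product weights and for limits superior *)

Lemma sum_fpowerset_prod (R : comPzSemiRingType) (x : nat -> R) (s : nat) :
  \sum_(v <- fpowerset (upto s)) \prod_(j <- v) x j
  = \prod_(1 <= j < s.+1) (1 + x j).
Proof.
have upto0 : upto 0 = fset0 by apply/fsetP => j; rewrite mem_upto; case: j.
elim: s => [|s IH].
  by rewrite upto0 fpowerset0 big_seq_fset1 big_seq_fset0 big_nil.
have sNs : s.+1 \notin upto s by rewrite mem_upto ltnn andbF.
rewrite big_nat_recr//= -IH uptoS mulrDr mulr1.
rewrite (bigID (fun v : {fset nat} => s.+1 \notin v))/=; congr (_ + _).
  exact: (big_fpowerset_notin xpredT).
under eq_bigl do rewrite negbK.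
rewrite big_fpowerset_in// big_distrl/= big_seq [RHS]big_seq.
apply: eq_bigr => v; rewrite fpowersetE => vs.
by rewrite big_fsetU1 1?mulrC//; apply: contra sNs; apply: (fsubsetP vs).
Qed.

(** The limit superior is the infimum of the tail suprema, so a strict upper bound is already met by
    one tail. *)
Lemma limn_esup_lt_esups (R : realType) (u : nat -> \bar R) (M : \bar R) :
  (limn_esup u < M)%E -> exists N, (esups u N < M)%E.
Proof.
rewrite limn_esup_lim (cvg_lim _ (@cvg_esups_inf _ u))//.
by move=> /ereal_inf_lt[_ [N _ <-] uM]; exists N.
Qed.

Lemma le_esups (R : realType) (u : nat -> \bar R) (N n : nat) :
  (N <= n)%N -> (u n <= esups u N)%E.
Proof. by move=> Nn; apply: ereal_sup_ubound; exists n. Qed.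

(** The finitely many indices below N are absorbed into the constant by adding all their ratios |u i
    / v i|. *)
Lemma eventually_le_cst (R : realFieldType) (u v : nat -> R) (M : R) (N : nat) :
  (forall s, 0 <= u s) -> (forall s, (0 < s)%N -> 0 < v s) ->
  (forall s, (N <= s)%N -> (0 < s)%N -> u s <= M * v s) ->
  exists2 K, 0 <= K & forall s, (0 < s)%N -> u s <= K * v s.
Proof.
move=> u0 v0 uv; pose T := \sum_(i < N) `|u i / v i|.
have T0 : 0 <= T by exact: sumr_ge0.
exists (`|M| + T) => [|s s0]; first exact: addr_ge0.
rewrite mulrDl; have [Ns|sN] := leqP N s.
  apply: le_trans (uv _ Ns s0) _; apply: ler_wpDr.
    by rewrite mulr_ge0// ltW ?v0.
  by rewrite ler_wpM2r ?ler_norm// ltW ?v0.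
apply: ler_wpDl; first by rewrite mulr_ge0// ltW ?v0.
rewrite -ler_pdivrMr ?v0// /T (bigD1 (Ordinal sN))//=.
by apply: ler_wpDr; rewrite ?sumr_ge0// ler_norm.
Qed.

Section ProductWeights.
Variables (R : realType) (b alpha d : nat) (gamma : {fset nat} -> R).
Hypotheses (b_prime : prime b) (alpha_gt0 : (0 < alpha)%N) (d_gt0 : (0 < d)%N).
Hypothesis gamma_ge0 : forall u : {fset nat}, 0%N \notin u -> 0 <= gamma u.
Variable g : nat -> R.
Hypothesis gammaE :
  forall u : {fset nat}, 0%N \notin u -> gamma u = \prod_(j <- u) g j.

(** The factor g j is the weight of the singleton {j}, which avoids 0 because j is positive. *)
Lemma product_weight_ge0 (j : nat) : (0 < j)%N -> 0 <= g j.
Proof.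
move=> j0; have j1 : 0%N \notin [fset j]%fset by rewrite in_fset1 lt_eqF.
by have := gamma_ge0 j1; rewrite gammaE// big_seq_fset1.
Qed.

Lemma wsum_product_le_expR (l : R) (s : nat) : 0 < l <= 1 ->
  wsum b alpha d gamma l s
  <= expR (Ccst b alpha d l d * \sum_(1 <= j < s.+1) g j `^ l).
Proof.
move=> l01; set C := Ccst b alpha d l d.
have C0 : 0 <= C by exact: Ccst_ge0.
have [l0 _] := andP l01.
apply: (@le_trans _ _ (\prod_(1 <= j < s.+1) (1 + g j `^ l * C))).
  rewrite -sum_fpowerset_prod /wsum.
  rewrite [leRHS](bigID (fun v : {fset nat} => v != fset0))/=.
  (* The expanded product also contains the term of the empty set, which is nonnegative and is
     discarded. *)
  apply: ler_wpDr.
    by apply: sumr_ge0 => v _; apply: prodr_ge0 => j _; rewrite mulr_ge0 ?powR_ge0.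
  rewrite big_seq_cond [leRHS]big_seq_cond; apply: ler_sum => v /andP[].
  rewrite fpowersetE => /zero_notin_upto v0 _.
  rewrite gammaE// powR_prod => [|j jv]; last first.
    by apply: product_weight_ge0; case: j jv v0 => // ->.
  by rewrite big_split/= prod_fset_const.
(* Factor by factor, 1 + x <= exp x. *)
rewrite mulr_sumr expR_sum; apply: ler_prod => j _.
rewrite [C * _]mulrC expR_ge1Dx andbT.
by rewrite addr_ge0// mulr_ge0 ?powR_ge0.
Qed.

End ProductWeights.

(** * The four bounds on the criterion *)

Theorem corollary1 (R : realType) (b alpha d : nat) (gamma : {fset nat} -> R)
    (b_prime : prime b) (alpha_gt0 : (0 < alpha)%N) (d_gt0 : (0 < d)%N)
    (gamma_ge0 : forall u : {fset nat}, 0%N \notin u -> 0 <= gamma u) :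
  let lambda_range (lambda : R) :=
    ((2 * minn alpha d + 1)%N%:R)^-1 < lambda /\ lambda <= 1 in
  let B_bounded_by (bound : nat -> R) :=
    exists K : R, forall (s m : nat) (p : {poly 'F_b})
        (q : (d * s).-tuple {poly 'F_b}),
      (0 < s)%N -> (0 < m)%N -> cbc m alpha gamma p q ->
      Bcrit m alpha d gamma p q <= K * bound s in
  let product_weights (g : nat -> R) :=
    forall u : {fset nat}, 0%N \notin u -> gamma u = \prod_(j <- u) g j in
  [/\ (forall lambda : R, lambda_range lambda ->
        (limn (fun s : nat => (wsum b alpha d gamma lambda s)%:E) < +oo)%E ->
        B_bounded_by (fun=> 1)),
      (forall lambda q : R, lambda_range lambda -> 0 < q ->
        (limn_esup (fun s : nat =>
           (wsum b alpha d gamma lambda s / s%:R `^ q)%:E) < +oo)%E ->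
        B_bounded_by (fun s => s%:R `^ (q / lambda))),
      (forall g : nat -> R, product_weights g ->
        forall lambda : R, lambda_range lambda ->
        (\sum_(1 <= j <oo) (g j `^ lambda)%:E < +oo)%E ->
        B_bounded_by (fun=> 1))
    & (forall g : nat -> R, product_weights g ->
        forall A : R,
        limn_esup (fun s : nat =>
          ((\sum_(1 <= j < s.+1) g j) / ln s%:R)%:E) = A%:E ->
        forall eta : R, 0 < eta ->
        B_bounded_by (fun s => s%:R `^ (Ccst b alpha d 1 d * (A + eta))))].
Proof.
move=> lambda_range B_bounded_by product_weights.
have range01 (l : R) : lambda_range l -> 0 < l <= 1.
  by move=> [lgt ->]; rewrite andbT (le_lt_trans _ lgt)// invr_ge0.
(* All four parts go through this reduction: a bound w on [wsum] yields the bound w^(1/l) on the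
   criterion. *)
have wsum_bound (l : R) (w : nat -> R) : 0 < l <= 1 ->
    (forall s, (0 < s)%N -> wsum b alpha d gamma l s <= w s) ->
    forall (s m : nat) (p : {poly 'F_b}) (q : (d * s).-tuple {poly 'F_b}),
    (0 < s)%N -> Bcrit m alpha d gamma p q <= w s `^ l^-1.
  move=> l01 ww s m p q s0; have [l0 _] := andP l01.
  apply: le_trans (Bcrit_le_wsum b_prime alpha_gt0 d_gt0 gamma_ge0 m p q s0 l01) _.
  have w0 : 0 <= wsum b alpha d gamma l s by exact: wsum_ge0.
  by rewrite ge0_ler_powR ?nnegrE ?invr_ge0 ?(ltW l0) ?ww ?(le_trans w0) ?ww.
split.
- move=> l /range01 l01 limy; pose W s := (wsum b alpha d gamma l s)%:E.
  have Wnd : {homo W : n m / (n <= m)%N >-> (n <= m)%E}.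
    by move=> n m nm; rewrite lee_fin wsum_nondecreasing.
  move: limy; rewrite -/W (cvg_lim _ (ereal_nondecreasing_cvgn Wnd))// => supy.
  exists (fine (ereal_sup (range W)%classic) `^ l^-1) => s m p q s0 _ _; rewrite mulr1.
  apply: (wsum_bound _ (fun=> fine (ereal_sup (range W)%classic)) l01) => // t _.
  have Wt : (W t <= ereal_sup (range W)%classic)%E by apply: ereal_sup_ubound; exists t.
  (* The supremum is a real number: it is below +oo by assumption and above -oo because it dominates
     the real value W t. *)
  by rewrite -lee_fin fineK// fin_numE -ltey supy andbT -ltNye
             (lt_le_trans _ Wt)// ltNyr.
- move=> l q /range01 l01 q0 /limn_esup_lt_esups[N supy].
  have pow_gt0 s : (0 < s)%N -> 0 < s%:R `^ q :> R.
    by move=> s0; rewrite powR_gt0// ltr0n.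
  have [K K0 wK] : exists2 K : R, 0 <= K & forall s, (0 < s)%N ->
      wsum b alpha d gamma l s <= K * s%:R `^ q.
    apply: (@eventually_le_cst _ _ _ (fine (esups (fun s : nat =>
      (wsum b alpha d gamma l s / s%:R `^ q)%:E) N)) N) => // [s|s Ns s0].
      exact: wsum_ge0.
    rewrite -ler_pdivrMr ?pow_gt0// -lee_fin fineK; first exact: le_esups.
    rewrite fin_numE -ltey supy andbT -ltNye.
    by apply: lt_le_trans (le_esups _ Ns); rewrite ltNyr.
  exists (K `^ l^-1) => s m p qs s0 _ _.
  apply: le_trans (wsum_bound _ _ l01 wK _ _ _ _ s0) _.
  by rewrite powRM ?powR_ge0// -powRrM.
- move=> g gammaE l /range01 l01 sumy; set T := (\sum_(1 <= j <oo) _)%E in sumy.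
  (* Partial sums of a nonnegative series are at most its total T, so this exponential bounds [wsum]
     for every s. *)
  pose c := expR (Ccst b alpha d l d * fine T).
  exists (c `^ l^-1) => s m p q s0 _ _; rewrite mulr1.
  apply: (wsum_bound _ (fun=> c) l01) => // t _.
  have g0 j : (1 <= j)%N -> xpredT j -> (0 <= (g j `^ l)%:E)%E.
    by move=> _ _; rewrite lee_fin powR_ge0.
  apply: le_trans (wsum_product_le_expR b_prime alpha_gt0 d_gt0 gamma_ge0 gammaE _ l01) _.
  rewrite ler_expR ler_wpM2l ?Ccst_ge0// -lee_fin fineK.
    by rewrite -sumEFin; apply: nneseries_lim_ge.
  by rewrite ge0_fin_numE// nneseries_ge0.
- move=> g gammaE A limA eta eta0; set C := Ccst b alpha d 1 d.
  have one01 : 0 < (1 : R) <= 1 by rewrite ltr01 lexx.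
  (* The slack eta makes the inequality strict, so some tail supremum lies below A + eta. *)
  have /limn_esup_lt_esups[N] : (limn_esup (fun s : nat =>
      ((\sum_(1 <= j < s.+1) g j) / ln s%:R)%:E) < (A + eta)%:E)%E.
    by rewrite limA lte_fin ltrDl.
  move=> supA.
  have [K K0 wK] : exists2 K : R, 0 <= K & forall s, (0 < s)%N ->
      wsum b alpha d gamma 1 s <= K * s%:R `^ (C * (A + eta)).
    (* Requiring s >= 2 makes ln s positive, so the quotient by ln s can be cleared; s = 1 is left
       to the constant. *)
    apply: (@eventually_le_cst _ _ _ 1 (maxn N 2)) => [s|s s0|s].
    - exact: wsum_ge0.
    - by rewrite powR_gt0// ltr0n.
    rewrite geq_max => /andP[Ns s2] s0; rewrite mul1r.
    apply: le_trans (wsum_product_le_expR b_prime alpha_gt0 d_gt0 gamma_ge0 gammaE _ one01) _.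
    (* As s^x = exp (x ln s), comparing the exponents leaves sum_j g j <= (A + eta) ln s. *)
    rewrite [leRHS]/powR gt_eqF ?ltr0n// ler_expR -mulrA ler_wpM2l ?Ccst_ge0//.
    rewrite -ler_pdivrMr ?ln_gt0 ?ltr1n//.
    under eq_big_nat => j /andP[j0 _].
      rewrite powRr1 ?(product_weight_ge0 gamma_ge0 gammaE)//; over.
    rewrite -lee_fin; apply: le_trans (ltW supA).
    exact: (le_esups (fun s : nat => ((\sum_(1 <= j < s.+1) g j) / ln s%:R)%:E)).
  exists K => s m p q s0 _ _.
  apply: le_trans (wsum_bound _ _ one01 wK _ _ _ _ s0) _.
  by rewrite invr1 powRr1 // mulr_ge0 ?powR_ge0.
Qed.
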